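(* Let $G_1$ be any non-trivial graph and let $G_2$ be any graph. Then $\delta(G_1\circ G_2)\le \delta(G_1)+3/2$.
   Context: All graphs are simple and connected (possibly infinite) and every edge has length $1$. A graph $G$ is viewed as a geodesic metric space by identifying each edge isometrically with $[0,1]$; points of $G$ are its vertices and the interior points of its edges, and $d_G$ is the length of a shortest path. A graph is non-trivial if it has at least two vertices. Lexicographic product $G_1\circ G_2$: vertex set $V(G_1)\times V(G_2)$; two distinct vertices $(u_1,v_1)$ and $(u_2,v_2)$ are adjacent if either $[u_1,u_2]\in E(G_1)$, or $u_1=u_2$ and $[v_1,v_2]\in E(G_2)$. A geodesic triangle $T=\{x_1,x_2,x_3\}$ in a geodesic metric space $X$ is the union of three geodesics $[x_1x_2],[x_2x_3],[x_3x_1]$. It is $\delta$-thin if every point of each side is at distance at most $\delta$ from the union of the other two sides; $\delta(T)=\inf\{\delta\ge 0: T \text{ is } \delta\text{-thin}\}$ and $\delta(X)=\sup\{\delta(T): T \text{ a geodesic triangle in } X\}\in[0,\infty]$. *)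

(* Defs.v *)
From HB Require Import structures.
From Stdlib Require Import Relation_Operators.
From mathcomp Require Import all_boot all_order all_algebra.
From mathcomp Require Import all_classical all_reals.
From mathcomp Require Import ereal topology numfun ring.

Set Implicit Arguments.
Unset Strict Implicit.
Unset Printing Implicit Defensive.

Import Order.TTheory GRing.Theory Num.Theory.

Local Open Scope classical_set_scope.
Local Open Scope ring_scope.

Section Hyperbolicity.
Context {R : realType}.

Definition is_geodesic (X : metricType R) (x y : X) (A : set X) : Prop :=
  exists g : R -> X,
    [/\ g 0 = x, g (mdist x y) = y,
        {in `[0, mdist x y] &, forall s t, mdist (g s) (g t) = `|s - t|} &
        A = g @` `[0, mdist x y] ].

Record geodesic_triangle (X : metricType R) := GeodesicTriangle {
  tri1 : X;
  tri2 : X;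
  tri3 : X;
  side12 : set X;
  side23 : set X;
  side31 : set X;
  side12_geodesic : is_geodesic tri1 tri2 side12;
  side23_geodesic : is_geodesic tri2 tri3 side23;
  side31_geodesic : is_geodesic tri3 tri1 side31
}.

Definition point_set_dist (X : metricType R) (p : X) (A : set X) : R :=
  inf [set mdist p q | q in A].

Definition thin_triangle (X : metricType R) (delta : R)
    (T : geodesic_triangle X) : Prop :=
  [/\ forall p, side12 T p ->
        point_set_dist p (side23 T `|` side31 T) <= delta,
      forall p, side23 T p ->
        point_set_dist p (side31 T `|` side12 T) <= delta &
      forall p, side31 T p ->
        point_set_dist p (side12 T `|` side23 T) <= delta].

Definition triangle_delta (X : metricType R) (T : geodesic_triangle X) :
    \bar R :=
  ereal_inf [set delta%:E | delta in
    [set delta : R | 0 <= delta /\ thin_triangle delta T]].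

Definition hyperbolicity (X : metricType R) : \bar R :=
  ereal_sup (range (@triangle_delta X)).

End Hyperbolicity.

Record graph := Graph {
  vertex :> Type;
  adj : vertex -> vertex -> Prop;
  adj_sym : forall u v, adj u v -> adj v u;
  adj_irr : forall u, ~ adj u u;
  graph_inhabited : inhabited vertex;
  graph_connected : forall u v, clos_refl_trans vertex adj u v
}.

Definition nontrivial_graph (G : graph) : Prop := exists u v : G, u <> v.

Section Lexicographic.
Variables G1 G2 : graph.

Definition lex_adj (x y : G1 * G2) : Prop :=
  adj x.1 y.1 \/ (x.1 = y.1 /\ adj x.2 y.2).

Lemma lex_adj_sym x y : lex_adj x y -> lex_adj y x.
Proof.
by case=> [/adj_sym|[/esym e /adj_sym]]; [left|right].
Qed.

Lemma lex_adj_irr x : ~ lex_adj x x.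
Proof. by case=> [|[_]]; exact: adj_irr. Qed.

Lemma lex_inhabited : inhabited (G1 * G2).
Proof.
by have [u] := graph_inhabited G1; have [v] := graph_inhabited G2; split.
Qed.

Lemma lex_connected x y : clos_refl_trans (G1 * G2) lex_adj x y.
Proof.
case: x y => [u1 v1] [u2 v2]; apply: (@rt_trans _ _ _ (u2, v1)).
- elim: (graph_connected u1 u2) => [u u' uu'|u|u w u' _ h _ h'].
  + by apply: rt_step; left.
  + exact: rt_refl.
  + exact: rt_trans h h'.
- elim: (graph_connected v1 v2) => [v v' vv'|v|v w v' _ h _ h'].
  + by apply: rt_step; right.
  + exact: rt_refl.
  + exact: rt_trans h h'.
Qed.

(* Distinctness of adjacent vertices is automatic, by [lex_adj_irr]. *)
Definition lexicographic_product : graph :=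
  Graph lex_adj_sym lex_adj_irr lex_inhabited lex_connected.

End Lexicographic.

(* A point is encoded by its barycentric coordinates, as in the geometric
  realization of a one-dimensional simplicial complex: the vertex [v] is the
  indicator function of [v], and the point at distance [t] from [u] on the edge
  [u v] has weight [1 - t] at [u] and [t] at [v].  In particular
  [edge_point u v t = edge_point v u (1 - t)] and the endpoints of edges are
  identified with the vertices, with no quotient needed. *)

Section MetricGraph.
Variables (R : realType) (G : graph).

Definition vertex_point (v : G) : G -> R := \1_[set v].

Definition edge_point (u v : G) (t : R) : G -> R :=
  fun w => (1 - t) * vertex_point u w + t * vertex_point v w.

Definition is_graph_point (p : G -> R) : Prop :=
  (exists v, p = vertex_point v) \/
  (exists u v t, [/\ adj u v, 0 <= t <= 1 & p = edge_point u v t]).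

Record graph_point := GraphPoint {
  bary :> G -> R;
  baryP : is_graph_point bary
}.

Lemma bary_inj (p q : graph_point) : bary p = bary q -> p = q.
Proof.
case: p q => [p hp] [q hq] /= e; case: _ / e hq => hq.
by rewrite (Prop_irrelevance hp hq).
Qed.

(* [polyline p q l]: there is a path of length [l] from [p] to [q] that is a
   concatenation of finitely many segments, each contained in one edge. *)
Inductive polyline : (G -> R) -> (G -> R) -> R -> Prop :=
| polyline_nil p : polyline p p 0
| polyline_cons u v s t q l :
    adj u v -> 0 <= s <= 1 -> 0 <= t <= 1 ->
    polyline (edge_point u v t) q l ->
    polyline (edge_point u v s) q (`|s - t| + l).

(* The length metric; this infimum over all polylines is attained. *)
Definition graph_dist (p q : graph_point) : R :=
  inf [set l | polyline p q l].

Lemma edge_point0 u v : edge_point u v 0 = vertex_point u.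
Proof. by apply/funext => w; rewrite /edge_point subr0 mul1r mul0r addr0. Qed.

Lemma edge_point1 u v : edge_point u v 1 = vertex_point v.
Proof. by apply/funext => w; rewrite /edge_point subrr mul1r mul0r add0r. Qed.

Lemma polyline_cat p q r l m :
  polyline p q l -> polyline q r m -> polyline p r (l + m).
Proof.
elim=> [p'|u v s t q' l' uv s01 t01 _ ih] qr; first by rewrite add0r.
by rewrite -addrA; apply: polyline_cons => //; exact: ih.
Qed.

Lemma polyline_seg u v s t : adj u v -> 0 <= s <= 1 -> 0 <= t <= 1 ->
  polyline (edge_point u v s) (edge_point u v t) `|s - t|.
Proof.
move=> uv s01 t01; rewrite -[X in polyline _ _ X]addr0.
by apply: polyline_cons => //; exact: polyline_nil.
Qed.

Lemma polyline_rev p q l : polyline p q l -> polyline q p l.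
Proof.
elim=> [p'|u v s t q' l' uv s01 t01 _ ih]; first exact: polyline_nil.
by rewrite addrC; apply: (polyline_cat ih); rewrite distrC; exact: polyline_seg.
Qed.

Lemma polyline_bary p q l w : polyline p q l -> `|p w - q w| <= l.
Proof.
elim=> [p'|u v s t q' l' uv s01 t01 _ ih]; first by rewrite subrr normr0.
rewrite (le_trans (ler_distD (edge_point u v t w) _ _))// lerD// {ih}.
have -> : edge_point u v s w - edge_point u v t w =
    (s - t) * (vertex_point v w - vertex_point u w).
  by rewrite /edge_point; ring.
rewrite normrM ler_piMr// /vertex_point !indicE.
by do 2 case: (_ \in _); rewrite /= ?subrr ?subr0 ?sub0r ?normrN ?normr0 ?normr1.
Qed.

Lemma polyline_ge0 p q l : polyline p q l -> 0 <= l.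
Proof. by elim=> // u v s t q' l' _ _ _ _ l0; rewrite addr_ge0. Qed.

Lemma polyline_vertex u v : exists l,
  polyline (vertex_point u) (vertex_point v) l.
Proof.
elim: (graph_connected u v) => [a b ab|a|a b c _ [l hl] _ [m hm]].
- exists `|0 - 1|; rewrite -(edge_point0 a b) -(edge_point1 a b).
  by apply: polyline_seg; rewrite ?lexx ?ler01.
- by exists 0; exact: polyline_nil.
- by exists (l + m); exact: polyline_cat hl hm.
Qed.

Lemma polyline_to_vertex (p : graph_point) : exists v l,
  polyline p (vertex_point v) l.
Proof.
case: p => p /= [[v ->]|[u [v [t [uv t01 ->]]]]].
  by exists v, 0; exact: polyline_nil.
exists u, `|t - 0|; rewrite -(edge_point0 u v).
by apply: polyline_seg; rewrite ?lexx ?ler01.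
Qed.

Lemma polyline_exists (p q : graph_point) : exists l, polyline p q l.
Proof.
have [u [l hl]] := polyline_to_vertex p.
have [v [m hm]] := polyline_to_vertex q.
have [k hk] := polyline_vertex u v.
exists (l + (k + m)).
exact: polyline_cat hl (polyline_cat hk (polyline_rev hm)).
Qed.

Lemma polyline_has_inf (p q : graph_point) : has_inf [set l | polyline p q l].
Proof.
split; first exact: polyline_exists.
by exists 0 => l /polyline_ge0.
Qed.

Lemma graph_dist_le (p q : graph_point) l : polyline p q l -> graph_dist p q <= l.
Proof.
move=> h; apply: ge_inf => //; by case: (polyline_has_inf p q).
Qed.

Lemma graph_dist_bary (p q : graph_point) w : `|p w - q w| <= graph_dist p q.
Proof.
apply: lb_le_inf; first exact: polyline_exists.
by move=> l /polyline_bary.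
Qed.

Lemma graph_distxx p : graph_dist p p = 0.
Proof.
apply/eqP; rewrite eq_le graph_dist_le /=; last exact: polyline_nil.
by apply: lb_le_inf; [exact: polyline_exists|move=> l /polyline_ge0].
Qed.

Lemma graph_dist_eq0 p q : graph_dist p q = 0 -> p = q.
Proof.
move=> pq0; apply: bary_inj; apply/funext => w; apply/eqP.
by rewrite -subr_eq0 -normr_le0 -pq0 graph_dist_bary.
Qed.

Lemma graph_distC p q : graph_dist p q = graph_dist q p.
Proof.
by congr inf; apply/seteqP; split=> l /polyline_rev.
Qed.

Lemma graph_dist_triangle q p r :
  graph_dist p r <= graph_dist p q + graph_dist q r.
Proof.
rewrite -lerBlDr; apply: lb_le_inf; first exact: polyline_exists.
move=> l pq; rewrite lerBlDr -lerBlDl.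
apply: lb_le_inf; first exact: polyline_exists.
move=> m qr; rewrite lerBlDl.
by apply: graph_dist_le; exact: polyline_cat pq qr.
Qed.

HB.instance Definition _ := gen_eqMixin graph_point.
HB.instance Definition _ := gen_choiceMixin graph_point.
HB.instance Definition _ := isMetric.Build R graph_point
  graph_distxx graph_dist_eq0 graph_distC graph_dist_triangle.

Lemma mdist_graphE (p q : graph_point) : mdist p q = graph_dist p q.
Proof. by []. Qed.

Lemma edge_isometry (u v : G) (s t : R) (p q : graph_point) :
  adj u v -> 0 <= s <= 1 -> 0 <= t <= 1 ->
  bary p = edge_point u v s -> bary q = edge_point u v t ->
  mdist p q = `|s - t|.
Proof.
move=> uv s01 t01 ps qt; apply/eqP; rewrite eq_le; apply/andP; split.
  by apply: graph_dist_le; rewrite ps qt; exact: polyline_seg.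
have vu : (v \in [set u]) = false.
  by apply/negbTE/negP => /set_mem /= e; apply: (@adj_irr G u); rewrite -{2}e.
have := graph_dist_bary p q v; rewrite ps qt /edge_point /vertex_point.
by rewrite !indicE vu mem_set//= !mulr0 !add0r !mulr1.
Qed.

End MetricGraph.

Definition metric_graph (R : realType) (G : graph) : metricType R :=
  graph_point R G.

Definition graph_delta (R : realType) (G : graph) : \bar R :=
  hyperbolicity (metric_graph R G).

(* Main.v *)
(* Let [x'] denote the projection of a point [x] of the lexicographic product to
  [G1]; it is 1-Lipschitz and collapses the vertical edges, those inside a copy
  of [G2].  Vertices in distinct fibres are as far apart as their projections,
  while any two vertices in the same fibre are at distance at most 2.

  Let [p] lie on the side [x y] of a geodesic triangle [x y z] and suppose that
  [p] is farther than [delta + 3 / 2] from both [x] and [y].  The side [x y],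
  being longer than 3, then projects to a geodesic of [G1], up to vertical
  pieces of length at most [1 / 2] at its ends.  Compare [x' y' z'] with a
  geodesic triangle of [G1]: its side [x' y'] is the projection of [x y], and
  some [q'] on another side, say [x' z'], is within [delta] of [p'].  If [x z]
  also projects to a geodesic, choose the latter as the side [x' z'] and lift
  [q'] to [q] on [x z]: either [d(p, q) <= d(p', q')], or the edges of [p] and [q]
  share a fibre, and then a point of [x z] slightly before [q] is within
  [d(p', q') + 3 / 2] of [p].  If [x z] does not project to a geodesic, then,
  since [q'] is far from [x'], its length is at most 2 and [q'] is near [z'];
  two horizontally adjacent vertices on [x z] then settle the matter. *)
Require Import Defs.
From Stdlib Require Import Operators_Properties.
From mathcomp Require Import all_boot all_order all_algebra.
From mathcomp Require Import all_classical all_reals.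
From mathcomp Require Import ereal topology numfun ring lra.

Set Implicit Arguments.
Unset Strict Implicit.
Unset Printing Implicit Defensive.

Import Order.TTheory GRing.Theory Num.Theory.

Local Open Scope classical_set_scope.
Local Open Scope ring_scope.

Local Notation dist := mdist.

(** * Geodesics and isometric curves in metric spaces *)

Section MetricSpace.
Context {R : realType}.
Implicit Types X Y : metricType R.

Lemma dist_eq0 X (x y : X) : dist x y <= 0 -> x = y.
Proof.
by move=> h; apply: mdist_positivity; apply/eqP; rewrite eq_le h mdist_ge0.
Qed.

Lemma dist_gt0_neq X (x y : X) : 0 < dist x y -> x <> y.
Proof. by move=> h e; rewrite e mdistxx ltxx in h. Qed.

Lemma norm_cases (s : R) :
  (`|s| = s /\ 0 <= s) \/ (`|s| = - s /\ s <= 0).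
Proof. case: (leP 0 s) => s0; [left; rewrite ger0_norm//|right].
by rewrite ltr0_norm// ltW. Qed.

Definition isometric_on X (f : R -> X) (i j : R) : Prop :=
  forall s t, i <= s <= j -> i <= t <= j -> dist (f s) (f t) = `|s - t|.

Lemma is_geodesicP X (x y : X) A : is_geodesic x y A ->
  exists g : R -> X, [/\ g 0 = x, g (dist x y) = y,
    isometric_on g 0 (dist x y) &
    forall p, A p <-> exists2 r, 0 <= r <= dist x y & p = g r].
Proof.
case=> g [g0 gL giso ->]; exists g.
have giso' : isometric_on g 0 (dist x y).
  by move=> s t hs ht; apply: giso; rewrite in_itv.
split=> // p; split=> [[r /=]|[r hr ->]].
  by rewrite in_itv /= => hr <-; exists r.
by exists r => //=; rewrite in_itv.
Qed.

Lemma isometric_geodesic X (x y : X) (g : R -> X) :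
  g 0 = x -> g (dist x y) = y -> isometric_on g 0 (dist x y) ->
  is_geodesic x y (g @` `[0, dist x y]).
Proof.
move=> g0 gL giso; exists g; split=> // s t; rewrite !in_itv /=; exact: giso.
Qed.

Lemma geodesic_ends X (x y : X) A : is_geodesic x y A -> A x /\ A y.
Proof.
move=> /is_geodesicP[g [g0 gL _ AE]]; split; apply/AE.
  by exists 0 => //; rewrite lexx mdist_ge0.
by exists (dist x y) => //; rewrite lexx mdist_ge0.
Qed.

Lemma geodesic_between X (x y p : X) A : is_geodesic x y A -> A p ->
  dist x p + dist p y = dist x y.
Proof.
move=> /is_geodesicP[g [g0 gL giso AE]] /AE[r hr ->].
have := giso 0 r; rewrite g0 => ->; [|lra|lra].
have := giso r (dist x y); rewrite gL => ->; [|lra|lra].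
by rewrite !ler0_norm; lra.
Qed.

Lemma isometric_rev X (g : R -> X) (L : R) :
  isometric_on g 0 L -> isometric_on (fun r => g (L - r)) 0 L.
Proof.
move=> h s t /andP[s0 sL] /andP[t0 tL]; rewrite h; try lra.
by rewrite opprB addrC addrA subrK distrC.
Qed.

Lemma is_geodesic_sym X (x y : X) A : is_geodesic x y A -> is_geodesic y x A.
Proof.
move=> /is_geodesicP[g [g0 gL giso AE]].
have -> : A = (fun r => g (dist x y - r)) @` `[0, dist y x].
  apply/seteqP; split=> p.
    move=> /AE[r hr ->]; exists (dist x y - r); last by rewrite subKr.
    by rewrite /= in_itv /= (metric_sym y); lra.
  move=> [r] /=; rewrite in_itv /= (metric_sym y) => hr <-; apply/AE.
  by exists (dist x y - r) => //; lra.
apply: isometric_geodesic; rewrite ?(metric_sym y) ?subr0 ?subrr//.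
exact: isometric_rev.
Qed.

Lemma is_geodesic_cat X (x y z : X) A B : is_geodesic x y A ->
  is_geodesic y z B -> dist x z = dist x y + dist y z ->
  exists C, is_geodesic x z C.
Proof.
move=> /is_geodesicP[f [f0 fL fiso _]] /is_geodesicP[g [g0 gL giso _]] xz.
have xy0 := mdist_ge0 x y; have yz0 := mdist_ge0 y z.
pose h r := if r <= dist x y then f r else g (r - dist x y).
exists (h @` `[0, dist x z]); apply: isometric_geodesic; rewrite /h.
- by rewrite xy0.
- rewrite xz; case: ifPn => [le|_]; last by rewrite addrC addKr gL.
  have yz : dist y z = 0 by lra.
  by rewrite yz addr0 fL -(dist_eq0 (_ : dist y z <= 0))// yz.
(* The route through [y] gives the upper bound; a shortcut between the two pieces would shorten the
   way from [x] to [z], which gives the lower one. *)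
have mixed r r' : 0 <= r <= dist x y -> dist x y <= r' <= dist x z ->
    dist (f r) (g (r' - dist x y)) = r' - r.
  move=> hr hr'; apply/eqP; rewrite eq_le; apply/andP; split.
    have := metric_triangle (f r) y (g (r' - dist x y)).
    have -> : dist (f r) y = dist x y - r.
      have := fiso r (dist x y); rewrite fL => ->; try lra.
      by case: (norm_cases (r - dist x y)) => -[-> ?]; lra.
    have -> : dist y (g (r' - dist x y)) = r' - dist x y.
      have := giso 0 (r' - dist x y); rewrite g0 => ->; try lra.
      by case: (norm_cases (0 - (r' - dist x y))) => -[-> ?]; lra.
    lra.
  have := metric_triangle x (f r) z.
  have := metric_triangle (f r) (g (r' - dist x y)) z.
  have -> : dist x (f r) = r.
    have := fiso 0 r; rewrite f0 => ->; try lra.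
    by case: (norm_cases (0 - r)) => -[-> ?]; lra.
  have -> : dist (g (r' - dist x y)) z = dist x z - r'.
    have := giso (r' - dist x y) (dist y z); rewrite gL => ->; try lra.
    by case: (norm_cases (r' - dist x y - dist y z)) => -[-> ?]; lra.
  lra.
move=> s t hs ht; case: ifPn => s1; case: ifPn => t1.
- by apply: fiso; lra.
- move: t1; rewrite -ltNge => t1; rewrite mixed; try lra.
  by case: (norm_cases (s - t)) => -[-> ?]; lra.
- move: s1; rewrite -ltNge => s1; rewrite metric_sym mixed; try lra.
  by case: (norm_cases (s - t)) => -[-> ?]; lra.
- move: s1 t1; rewrite -!ltNge => s1 t1; rewrite giso; try lra.
  by congr `|_|; lra.
Qed.

(** By the triangle inequality, a shortening between intermediate points would carry over to the
    images of the two ends. *)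
Lemma lipschitz_isometric X Y (f : X -> Y) (g : R -> X) (i j : R) :
  (forall p q, dist (f p) (f q) <= dist p q) -> i <= j ->
  isometric_on g i j -> j - i <= dist (f (g i)) (f (g j)) ->
  isometric_on (f \o g) i j.
Proof.
move=> flip ij giso fij.
suff mono s t : i <= s <= j -> i <= t <= j -> s <= t ->
    dist (f (g s)) (f (g t)) = t - s.
  move=> s t hs ht; case: (leP s t) => st /=.
    by rewrite (mono _ _ hs ht st) ler0_norm; lra.
  by rewrite metric_sym (mono _ _ ht hs (ltW st)) gtr0_norm; lra.
move=> hs ht st; apply/eqP; rewrite eq_le; apply/andP; split.
  apply: le_trans (flip _ _) _; rewrite giso// ler0_norm; lra.
have h1 := metric_triangle (f (g i)) (f (g s)) (f (g j)).
have h2 := metric_triangle (f (g s)) (f (g t)) (f (g j)).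
have h3 := flip (g i) (g s); have h4 := flip (g t) (g j).
rewrite giso in h3; try lra.
rewrite giso in h4; try lra.
rewrite ler0_norm in h3; last lra.
rewrite ler0_norm in h4; last lra.
lra.
Qed.

End MetricSpace.

(** * Distances in a metric graph *)

Section MetricGraph.
Context {R : realType} {G : graph}.
Implicit Types (a b u v w : G) (s t : R) (x y p q : graph_point R G).

Lemma vertex_point1 u : vertex_point R u u = 1.
Proof. by rewrite /vertex_point indicE mem_set. Qed.

Lemma vertex_point0 u w : w <> u -> vertex_point R u w = 0.
Proof. by move=> wu; rewrite /vertex_point indicE memNset. Qed.

Lemma adj_neq u v : adj u v -> u <> v.
Proof. by move=> uv e; apply: (@adj_irr G u); rewrite {2}e. Qed.

Lemma vertex_edge_eq w a b s : adj a b ->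
  vertex_point R w = edge_point a b s -> (w = a /\ s = 0) \/ (w = b /\ s = 1).
Proof.
move=> ab e; have nab := adj_neq ab; have nba := adj_neq (adj_sym ab).
have ea := congr1 (fun f => f a) e; have eb := congr1 (fun f => f b) e.
rewrite /= /edge_point !vertex_point1 (vertex_point0 nab) (vertex_point0 nba)
  in ea eb.
have [wa|wa] := pselect (w = a).
  by left; split=> //; rewrite wa (vertex_point0 nba) in eb; lra.
have [wb|wb] := pselect (w = b).
  by right; split=> //; rewrite wb vertex_point1 in eb; lra.
have wa' : a <> w by move=> /esym. have wb' : b <> w by move=> /esym.
by rewrite !vertex_point0// in ea eb; lra.
Qed.

(** Away from [s = 0] and [s = 1] the function is nonzero exactly at the two ends of its edge, so it
    determines the edge up to orientation. *)
Lemma edge_edge_eq a a' b b' s t : adj a a' -> adj b b' ->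
  edge_point a a' s = edge_point b b' t ->
  [\/ [/\ a = b, a' = b' & s = t], [/\ a = b', a' = b & s = 1 - t] |
      exists v, [/\ edge_point a a' s = vertex_point R v,
        (v = a /\ s = 0) \/ (v = a' /\ s = 1) &
        (v = b /\ t = 0) \/ (v = b' /\ t = 1)] ].
Proof.
move=> aa bb e; have naa := adj_neq aa; have nbb := adj_neq bb.
suff: [\/ [/\ a = b, a' = b' & s = t], [/\ a = b', a' = b & s = 1 - t] |
    (s = 0 \/ s = 1)].
  case=> [?|?|[s0|s1]]; [by constructor 1|by constructor 2| |]; constructor 3.
    exists a; move: e; rewrite s0 edge_point0 => e; split=> //; first by left.
    exact: vertex_edge_eq.
  exists a'; move: e; rewrite s1 edge_point1 => e; split=> //; first by right.
  exact: vertex_edge_eq.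
have ev (w : G) : edge_point a a' s w = edge_point b b' t w by rewrite e.
have := ev a; have := ev a'; rewrite /edge_point !vertex_point1.
rewrite (vertex_point0 naa) (vertex_point0 (nesym naa)).
have [ab|ab] := pselect (a = b); last rewrite (vertex_point0 ab).
  rewrite -ab vertex_point1 (vertex_point0 (nesym naa)).
  have [ab'|ab'] := pselect (a' = b'); last rewrite (vertex_point0 ab').
    by rewrite -ab' vertex_point1 => ? ?; constructor 1; split=> //; lra.
  by move=> ? ?; constructor 3; left; lra.
have [ab'|ab'] := pselect (a = b'); last rewrite (vertex_point0 ab').
  rewrite -ab' vertex_point1 (vertex_point0 (nesym naa)).
  have [a'b|a'b] := pselect (a' = b); last rewrite (vertex_point0 a'b).
    by rewrite -a'b vertex_point1 => ? ?; constructor 2; split=> //; lra.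
  by move=> ? ?; constructor 3; left; lra.
by move=> _ ?; constructor 3; right; lra.
Qed.

Definition vpoint v : graph_point R G :=
  GraphPoint (or_introl (ex_intro _ v (erefl (vertex_point R v)))).

Definition on_edge x a b s : Prop :=
  [/\ adj a b, 0 <= s <= 1 & bary x = edge_point a b s].

Lemma on_edge_exists a b s : adj a b -> 0 <= s <= 1 -> exists x, on_edge x a b s.
Proof.
move=> ab s01.
have h : is_graph_point (edge_point (R := R) a b s) by right; exists a, b, s.
by exists (GraphPoint h).
Qed.

Lemma edge_point_flip a b s : edge_point a b s = edge_point b a (1 - s).
Proof. by apply/funext => w; rewrite /edge_point; ring. Qed.

Lemma on_edge_flip x a b s : on_edge x a b s -> on_edge x b a (1 - s).
Proof.
move=> [ab s01 xE]; split; [exact: adj_sym|lra|].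
by rewrite xE edge_point_flip.
Qed.

Lemma on_edge_uniq x y a b s : on_edge x a b s -> on_edge y a b s -> x = y.
Proof. by move=> [_ _ xE] [_ _ yE]; apply: bary_inj; rewrite xE. Qed.

Lemma on_edge_vpoint a b : adj a b -> on_edge (vpoint a) a b 0.
Proof. by move=> ab; split=> //; rewrite ?lexx ?ler01// edge_point0. Qed.

Lemma on_edge_vpoint' a b : adj a b -> on_edge (vpoint b) a b 1.
Proof. by move=> ab; split=> //; rewrite ?lexx ?ler01// edge_point1. Qed.

Lemma on_edge0 x a b : on_edge x a b 0 -> x = vpoint a.
Proof. by move=> [_ _ xE]; apply: bary_inj; rewrite xE edge_point0. Qed.

Lemma on_edge1 x a b : on_edge x a b 1 -> x = vpoint b.
Proof. by move=> [_ _ xE]; apply: bary_inj; rewrite xE edge_point1. Qed.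

Lemma vpoint_on_edge v a b s : on_edge (vpoint v) a b s ->
  (v = a /\ s = 0) \/ (v = b /\ s = 1).
Proof. by move=> [ab _ /= /(vertex_edge_eq ab)]. Qed.

Lemma on_edge_dist x y a b s t :
  on_edge x a b s -> on_edge y a b t -> dist x y = `|s - t|.
Proof. by move=> [ab s01 xE] [_ t01 yE]; exact: edge_isometry xE yE. Qed.

Lemma on_edge_dist_ends x a b s : on_edge x a b s ->
  dist x (vpoint a) = s /\ dist x (vpoint b) = 1 - s.
Proof.
move=> xab; have [ab s01 _] := xab.
rewrite (on_edge_dist xab (on_edge_vpoint ab)).
rewrite (on_edge_dist xab (on_edge_vpoint' ab)).
by rewrite ger0_norm ?ler0_norm; lra.
Qed.

(** As long as the segments lie in the edge [a b], induction applies to the next breakpoint. A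
    segment in another edge must start at an end of [a b], and from there the length is at least the
    distance to [y]. *)
Lemma polyline_exit (f g : G -> R) l : polyline f g l ->
  forall x y a b s, f = bary x -> g = bary y -> on_edge x a b s ->
  [\/ exists t, on_edge y a b t, s + dist (vpoint a) y <= l |
      1 - s + dist (vpoint b) y <= l].
Proof.
elim=> {f g l} [f' x y a b s -> /bary_inj <- xab|
  u v s' t' g' l uv s'01 t'01 pl ih].
  by constructor 1; exists s.
move=> x y a b s xE yE [ab s01 xE'].
have [x1 x1uv] := on_edge_exists uv t'01.
have [_ _ x1E] := x1uv.
have n1 := ler_norm (s' - t').
have n2 := ler_norm (- (s' - t')); rewrite normrN in n2.
have xy : dist x y <= `|s' - t'| + l.
  by apply: graph_dist_le; rewrite -xE -yE; exact: polyline_cons.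
have := xE; rewrite xE' => /esym e.
have [[au bv ss]|[av bu ss]|[w [wE wab _]]] := edge_edge_eq ab uv e.
- rewrite -au -bv in x1uv.
  have [|h|h] := ih x1 y a b t' (esym x1E) yE x1uv; [by constructor 1| |].
    by constructor 2; lra.
  by constructor 3; lra.
- move/on_edge_flip: x1uv; rewrite -av -bu => x1uv.
  have [|h|h] := ih x1 y a b _ (esym x1E) yE x1uv; [by constructor 1| |].
    by constructor 2; lra.
  by constructor 3; lra.
have xw : x = vpoint w by apply: bary_inj; rewrite xE'.
by case: wab => -[<- s0]; [constructor 2|constructor 3]; rewrite -xw; lra.
Qed.

(** The infimum over [polyline_exit]. This is the basic rule for computing distances from a point
    inside an edge. *)
Lemma dist_exit x y a b s : on_edge x a b s ->
  [\/ exists t, on_edge y a b t, dist x y = s + dist (vpoint a) y |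
      dist x y = 1 - s + dist (vpoint b) y].
Proof.
move=> xab; have [da db] := on_edge_dist_ends xab.
have ta := metric_triangle x (vpoint a) y.
have tb := metric_triangle x (vpoint b) y.
rewrite da in ta; rewrite db in tb.
have [?|nony] := pselect (exists t, on_edge y a b t); first by constructor 1.
have lb : Num.min (s + dist (vpoint a) y) (1 - s + dist (vpoint b) y)
    <= dist x y.
  apply: lb_le_inf; first exact: polyline_exists.
  move=> l pl; have [//|h|h] := polyline_exit pl erefl erefl xab.
    by rewrite ge_min h.
  by rewrite ge_min h orbT.
move: lb; rewrite ge_min => /orP[h|h]; [constructor 2|constructor 3]; lra.
Qed.

Lemma dist_vpoint v x a b s : on_edge x a b s ->
  dist (vpoint v) x = s + dist (vpoint v) (vpoint a) \/
  dist (vpoint v) x = 1 - s + dist (vpoint v) (vpoint b).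
Proof.
move=> xab; rewrite ![dist (vpoint v) _]metric_sym.
have [da db] := on_edge_dist_ends xab.
have [[t /vpoint_on_edge[][-> _]]|?|?] := dist_exit (vpoint v) xab.
- by left; rewrite da mdistxx addr0.
- by right; rewrite db mdistxx addr0.
- by left.
- by right.
Qed.

(** * Walks and integrality of vertex distances *)

Fixpoint walk n u v : Prop :=
  if n is m.+1 then exists2 w, adj u w & walk m w v else u = v.

Lemma dist_adj u v : adj u v -> dist (vpoint u) (vpoint v) = 1.
Proof.
move=> uv; rewrite (on_edge_dist (on_edge_vpoint uv) (on_edge_vpoint' uv)).
by rewrite sub0r normrN normr1.
Qed.

Lemma walk_dist_le n u v : walk n u v -> dist (vpoint u) (vpoint v) <= n%:R.
Proof.
elim: n u => [u /= ->|n ih u /= [w uw /ih wv]]; first by rewrite mdistxx.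
have := metric_triangle (vpoint u) (vpoint w) (vpoint v).
by rewrite (dist_adj uw) mulrS; lra.
Qed.

(** Rounds a polyline to a walk. A start inside an edge must first reach one of its ends, hence the
    terms [s] and [1 - s]. *)
Lemma polyline_walk (f g : G -> R) l : polyline f g l ->
  forall w, g = vertex_point R w ->
  forall a b s, adj a b -> 0 <= s <= 1 -> f = edge_point a b s ->
  exists n, (walk n a w /\ s + n%:R <= l) \/ (walk n b w /\ 1 - s + n%:R <= l).
Proof.
elim=> {f g l} [f' w -> a b s ab _ e|u v s' t' g' l uv s'01 t'01 pl ih].
  exists 0%N; have [[-> ->]|[-> ->]] := vertex_edge_eq ab e; [left|right].
    by split=> //; lra.
  by split=> //; lra.
move=> w gE a b s ab s01 e.
have n1 := ler_norm (s' - t').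
have n2 := ler_norm (- (s' - t')); rewrite normrN in n2.
have [n [[wn h]|[wn h]]] := ih w gE u v t' uv t'01 erefl;
  have [[eu ev ss]|[ev eu ss]|[v0 [_ h1 h2]]] := edge_edge_eq uv ab e.
- by exists n; left; rewrite -eu; split=> //; lra.
- by exists n; right; rewrite -ev; split=> //; lra.
(* The polyline starts at the common vertex [v0]. If [v0] is [u], the walk starts there already; if
   it is [v], the edge to [u] is prepended, at a cost that the first segment and [t'] cover. *)
- case: h2 => -[e2 s0]; case: h1 => -[e1 s0'];
    [exists n; left|exists n.+1; left|exists n; right|exists n.+1; right];
    rewrite -e2 e1; (split; [|rewrite ?mulrS; lra]) => //;
    by exists u => //; exact: adj_sym.
- by exists n; right; rewrite -ev; split=> //; lra.
- by exists n; left; rewrite -eu; split=> //; lra.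
- case: h2 => -[e2 s0]; case: h1 => -[e1 s0'];
    [exists n.+1; left|exists n; left|exists n.+1; right|exists n; right];
    rewrite -e2 e1; (split; [|rewrite ?mulrS; lra]) => //;
    by exists v.
Qed.

Lemma exists_neighbor u v : u <> v -> exists w, adj u w.
Proof.
have := clos_rt_rt1n _ _ _ _ (graph_connected u v).
by case=> [//|w ? uw _ _]; exists w.
Qed.

(** A shortest walk attains the infimum, because every polyline is at least as long as some walk. *)
Lemma dist_vertex_walk u v :
  exists2 n, walk n u v & dist (vpoint u) (vpoint v) = n%:R.
Proof.
have [->|uv] := pselect (u = v).
  by exists 0%N => //; rewrite mdistxx.
have [w uw] := exists_neighbor uv.
have lw l : polyline (vertex_point R u) (vertex_point R v) l ->
    exists2 n, walk n u v & n%:R <= l.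
  have h01 : 0 <= (0 : R) <= 1 by rewrite lexx ler01.
  (* To apply [polyline_walk], the vertex [u] is seen as the point with parameter 0 on an edge
     [u w]. *)
  move=> pl; have [n [[wn h]|[wn h]]] :=
    polyline_walk pl erefl uw h01 (esym (edge_point0 R u w)).
  - by exists n => //; lra.
  - by exists n.+1; [exists w|rewrite mulrS; lra].
have ex : exists n, `[< walk n u v >].
  have [l /lw[n wn _]] := polyline_exists (vpoint u) (vpoint v).
  by exists n; exact/asboolP.
case: (ex_minnP ex) => n /asboolP wn minn; exists n => //.
apply/eqP; rewrite eq_le walk_dist_le//=.
apply: lb_le_inf; first exact: polyline_exists.
move=> l /lw[m wm ml]; apply: le_trans ml; rewrite ler_nat.
by apply: minn; exact/asboolP.
Qed.

Lemma dist_vertex_ge1 u v : 0 < dist (vpoint u) (vpoint v) ->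
  1 <= dist (vpoint u) (vpoint v).
Proof. by have [n _ ->] := dist_vertex_walk u v; rewrite ltr0n ler1n. Qed.

Lemma dist_vertex_ge2 u v : 1 < dist (vpoint u) (vpoint v) ->
  2 <= dist (vpoint u) (vpoint v).
Proof. by have [n _ ->] := dist_vertex_walk u v; rewrite ltr1n ler_nat. Qed.

(** * Existence and behaviour of geodesics *)

(** A curve of unit length cannot stay in the interior of an edge, and being geodesic it reaches an
    end as soon as the distance allows. *)
Lemma geodesic_exit x a b s (f : R -> graph_point R G) :
  on_edge x a b s -> f 0 = x -> isometric_on f 0 1 ->
  f s = vpoint a \/ f (1 - s) = vpoint b.
Proof.
wlog s2 : a b s / s <= 1 / 2 => [hwlog xab f0 fiso|xab f0 fiso].
  case: (leP s (1 / 2)) => s2; first exact: hwlog.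
  have s2' : 1 - s <= 1 / 2 by lra.
  have [fb|fa] := hwlog _ _ _ s2' (on_edge_flip xab) f0 fiso; first by right.
  by left; rewrite subKr in fa.
have [_ s01 _] := xab.
have d1 : dist x (f s) = s.
  by rewrite -f0 fiso; try lra; rewrite sub0r normrN ger0_norm; lra.
have d2 : dist x (f (1 - s)) = 1 - s.
  by rewrite -f0 fiso; try lra; rewrite sub0r normrN ger0_norm; lra.
have d12 : dist (f s) (f (1 - s)) = 1 - 2 * s.
  by rewrite fiso; try lra; rewrite ler0_norm; lra.
have toa p : dist (vpoint a) p <= 0 -> p = vpoint a by move=> /dist_eq0 ->.
have tob p : dist (vpoint b) p <= 0 -> p = vpoint b by move=> /dist_eq0 ->.
have edge2 t2 : on_edge (f (1 - s)) a b t2 ->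
    f s = vpoint a \/ f (1 - s) = vpoint b.
  move=> w2; have [_ t201 _] := w2; have := on_edge_dist xab w2; rewrite d2.
  case: (norm_cases (s - t2)) => -[-> ?] ?.
    left; have t20 : t2 = 0 by lra.
    rewrite t20 in w2; have := on_edge0 w2; suff -> : 1 - s = s by [].
    lra.
  right; have t21 : t2 = 1 by lra.
  by rewrite t21 in w2; exact: on_edge1 w2.
have [[t w1]|e1|e1] := dist_exit (f s) xab; first last.
- right; have se : s = 1 - s by have := mdist_ge0 (vpoint b) (f s); lra.
  by rewrite -se; apply: tob; lra.
- by left; apply: toa; lra.
have [_ t01 _] := w1; have := on_edge_dist xab w1; rewrite d1.
case: (norm_cases (s - t)) => -[-> ?] et.
  by left; have t0 : t = 0 by [lra]; rewrite t0 in w1; exact: on_edge0 w1.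
(* Now [f s] has moved towards [b], to the parameter [2 * s], while the distance from [x] to
   [f (1 - s)] is realized through [a]. Measuring from [f s] as well forces [s = 0], unless
   [f (1 - s)] is [b]. *)
have [[t2 /edge2]//|e2|e2] := dist_exit (f (1 - s)) xab; last first.
  by right; apply: tob; lra.
have [[t2 /edge2]//|e3|e3] := dist_exit (f (1 - s)) w1; last first.
  by right; apply: tob; lra.
left; have t0 : t = 0 by lra.
by rewrite t0 in w1; exact: on_edge0 w1.
Qed.

Lemma edge_geodesic x y a b s t : on_edge x a b s -> on_edge y a b t ->
  exists A, is_geodesic x y A.
Proof.
wlog st : x y s t / s <= t => [hwlog xab yab|xab yab].
  case: (leP s t) => st; first exact: hwlog xab yab.
  have [A hA] := hwlog _ _ _ _ (ltW st) yab xab.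
  by exists A; exact: is_geodesic_sym.
have [ab s01 _] := xab; have [_ t01 _] := yab.
have : forall r, exists p, 0 <= r <= 1 -> on_edge p a b r.
  move=> r; have [r01|r01] := pselect (0 <= r <= 1); last by exists x.
  by have [p hp] := on_edge_exists ab r01; exists p.
move=> /choice[g gP].
have L : dist x y = t - s.
  by rewrite (on_edge_dist xab yab) ler0_norm; lra.
exists ((fun r => g (s + r)) @` `[0, dist x y]).
apply: isometric_geodesic; rewrite ?L.
- by apply: on_edge_uniq xab; rewrite addr0; apply: gP.
- have -> : s + (t - s) = t by lra.
  by apply: on_edge_uniq yab; apply: gP.
move=> r r' hr hr'; rewrite (@on_edge_dist _ _ a b (s + r) (s + r')).
- by congr `|_|; lra.
- by apply: gP; lra.
- by apply: gP; lra.
Qed.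

Lemma graph_point_edge x : (exists v, x = vpoint v) \/
  exists a b s, on_edge x a b s.
Proof.
have [[v xE]|[a [b [s [ab s01 xE]]]]] := baryP x.
  by left; exists v; exact: bary_inj.
by right; exists a, b, s.
Qed.

(** Between vertices a geodesic is assembled along a shortest walk; points inside edges are then
    attached through the end that [dist_exit] provides. It supplies the sides of comparison
    triangles in [G1]. *)
Lemma geodesic_exists x y : exists A, is_geodesic x y A.
Proof.
have vv u v : exists A, is_geodesic (vpoint u) (vpoint v) A.
  have [n] := dist_vertex_walk u v; elim: n u => [u /= -> _|n ih u].
    exists ((fun=> vpoint v) @` `[0, dist (vpoint v) (vpoint v)]).
    apply: isometric_geodesic; rewrite ?mdistxx// => s t hs ht.
    by rewrite mdistxx; suff -> : s - t = 0 by [rewrite normr0]; lra.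
  move=> /= [w uw wv] duv.
  have := metric_triangle (vpoint u) (vpoint w) (vpoint v).
  have := walk_dist_le wv; rewrite duv (dist_adj uw) mulrS => h1 h2.
  have dwv : dist (vpoint w) (vpoint v) = n%:R by lra.
  have [A hA] := ih _ wv dwv.
  have [B hB] := edge_geodesic (on_edge_vpoint uw) (on_edge_vpoint' uw).
  by apply: is_geodesic_cat hB hA _; rewrite duv (dist_adj uw) dwv mulrS.
have ev z z' a b s : on_edge z a b s ->
    (forall v, exists A, is_geodesic (vpoint v) z' A) ->
    exists A, is_geodesic z z' A.
  move=> zab hv; have [ab _ _] := zab; have [da db] := on_edge_dist_ends zab.
  have [[t z'ab]|e|e] := dist_exit z' zab; first exact: edge_geodesic zab z'ab.
    have [A hA] := hv a; have [B hB] := edge_geodesic zab (on_edge_vpoint ab).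
    by apply: is_geodesic_cat hB hA _; rewrite da.
  have [A hA] := hv b; have [B hB] := edge_geodesic zab (on_edge_vpoint' ab).
  by apply: is_geodesic_cat hB hA _; rewrite db.
have pv z v : exists A, is_geodesic z (vpoint v) A.
  have [[w ->]//|[a [b [s zab]]]] := graph_point_edge z.
  exact: ev zab _.
have vp v z : exists A, is_geodesic (vpoint v) z A.
  by have [A hA] := pv z v; exists A; exact: is_geodesic_sym.
have [[w ->]//|[a [b [s xab]]]] := graph_point_edge x.
exact: ev xab _.
Qed.

End MetricGraph.

(** * The projection to the first factor and what it does to distances *)

Section Projection.
Context {R : realType} {G1 G2 : graph}.
Local Notation X := (lexicographic_product G1 G2).
Implicit Types (a b c e : X) (s t : R) (x y p q : graph_point R X).

(** Two descriptions of [x] as an edge point differ by orientation or meet in a vertex, so they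
    project to the same point. *)
Lemma proj_exists x : exists y : graph_point R G1,
  forall a b s, on_edge x a b s -> bary y = edge_point a.1 b.1 s.
Proof.
have flat u s : edge_point u u s = vertex_point R u.
  by apply/funext => w; rewrite /edge_point; ring.
(* For a point on no edge the condition is void and any vertex will do. *)
have [[a [b [s xab]]]|nox] := pselect (exists a b s, on_edge x a b s); last first.
  have [u] := graph_inhabited G1; exists (vpoint u) => a b s xab.
  by case: nox; exists a, b, s.
have [ab s01 xE] := xab.
have [y yE] : exists y : graph_point R G1, bary y = edge_point a.1 b.1 s.
  case: ab => [ab|[e _]].
    by have [y [_ _ yE]] := on_edge_exists ab s01; exists y.
  by exists (vpoint a.1); rewrite -e flat.
exists y => c e t [ce t01 xE']; rewrite yE.
have eqx := xE; rewrite xE' in eqx.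
have [[<- <- ->]//|[<- <- ->]|[w [_ h1 h2]]] := edge_edge_eq ce ab eqx.
  by rewrite [RHS]edge_point_flip subKr.
by case: h1 => -[<- ->]; case: h2 => -[<- ->]; rewrite ?edge_point0 ?edge_point1.
Qed.

(* As [edge_point u u s] is the vertex [u], vertical edges collapse. *)
Definition fproj x : graph_point R G1 := projT1 (cid (proj_exists x)).

Lemma proj_edge x a b s : on_edge x a b s ->
  bary (fproj x) = edge_point a.1 b.1 s.
Proof. by rewrite /fproj; case: cid => y /= h /h. Qed.

Definition horizontal x a b s : Prop := on_edge x a b s /\ adj a.1 b.1.

Lemma horizontal_flip x a b s : horizontal x a b s -> horizontal x b a (1 - s).
Proof. by move=> [/on_edge_flip ? /adj_sym]. Qed.

Lemma horizontal_proj x a b s : horizontal x a b s ->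
  on_edge (fproj x) a.1 b.1 s.
Proof. by move=> [xab ab]; split=> //; [case: xab|exact: proj_edge]. Qed.

Lemma vertical_proj x a b s : on_edge x a b s -> a.1 = b.1 ->
  fproj x = vpoint a.1.
Proof.
move=> /proj_edge xE e; apply: bary_inj; rewrite xE -e.
by apply/funext => w; rewrite /edge_point /=; ring.
Qed.

Hypothesis nt : nontrivial_graph G1.

(** Non-triviality of [G1] enters the proof here: every fibre has an adjacent fibre. *)
Lemma fibre_neighbor (u : G1) : exists w, adj u w.
Proof.
have [v [w vw]] := nt; have [uv|] := pselect (u = v).
  by apply: (@exists_neighbor _ _ w); rewrite uv.
exact: exists_neighbor.
Qed.

Lemma vpoint_horizontal a : exists b, horizontal (vpoint a) a b 0.
Proof.
have [w uw] := fibre_neighbor a.1; exists (w, a.2); split=> //.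
by apply: on_edge_vpoint; left.
Qed.

Lemma proj_vpoint a : fproj (vpoint a) = vpoint a.1.
Proof. by have [b /horizontal_proj/on_edge0] := vpoint_horizontal a. Qed.

Lemma dist_proj_vertex a b :
  dist (vpoint (R := R) a.1) (vpoint b.1) <= dist (vpoint (R := R) a) (vpoint b).
Proof.
have [n wn ->] := dist_vertex_walk (R := R) a b.
elim: n a wn => [a /= ->|n ih a /= [c ac /ih cb]]; first by rewrite mdistxx.
have := metric_triangle (vpoint (R := R) a.1) (vpoint c.1) (vpoint b.1).
have : dist (vpoint (R := R) a.1) (vpoint c.1) <= 1.
  by case: ac => [/(dist_adj (R := R)) ->//|[-> _]]; rewrite mdistxx ler01.
by rewrite mulrS; lra.
Qed.

(** The last horizontal step can land anywhere in its fibre; this takes at least one step, hence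
    [n.+1]. *)
Lemma walk_lift n (u u' : G1) (v v' : G2) : walk n.+1 u u' ->
  walk (G := X) n.+1 (u, v) (u', v').
Proof.
elim: n u v => [u v [w uw <-]|n ih u v [w uw wu']].
  by exists (w, v') => //; left.
by exists (w, v); [left|exact: ih].
Qed.

Lemma dist_fibre_neq a b : a.1 <> b.1 ->
  dist (vpoint (R := R) a) (vpoint b) = dist (vpoint (R := R) a.1) (vpoint b.1).
Proof.
move=> ab; apply/eqP; rewrite eq_le dist_proj_vertex andbT.
have [[|n] wn ->] := dist_vertex_walk (R := R) a.1 b.1; first by [].
apply: walk_dist_le; case: a b {ab} wn => [u v] [u' v']; exact: walk_lift.
Qed.

Lemma dist_hadj a b : adj a.1 b.1 -> dist (vpoint (R := R) a) (vpoint b) = 1.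
Proof. by move=> ab; apply: dist_adj; left. Qed.

(** A detour through an adjacent fibre costs two edges. *)
Lemma dist_fibre_eq a b : a.1 = b.1 -> dist (vpoint (R := R) a) (vpoint b) <= 2.
Proof.
move=> ab; have [w uw] := fibre_neighbor a.1; pose c : X := (w, a.2).
have := metric_triangle (vpoint (R := R) a) (vpoint c) (vpoint b).
rewrite (@dist_hadj a c uw) (@dist_hadj c b); first lra.
by rewrite -ab; exact: adj_sym.
Qed.

Lemma proj_same_edge x y a b s t : on_edge x a b s -> on_edge y a b t ->
  dist (fproj x) (fproj y) <= `|s - t|.
Proof.
move=> xab yab; have [[ab|[ab _]] _ _] := xab.
  by rewrite (on_edge_dist (horizontal_proj (conj xab ab))
    (horizontal_proj (conj yab ab))).
by rewrite (vertical_proj xab ab) (vertical_proj yab ab) mdistxx.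
Qed.

Lemma proj_end x a b s : on_edge x a b s -> dist (fproj x) (vpoint a.1) <= s.
Proof.
move=> xab; have [ab s01 _] := xab.
have := proj_same_edge xab (on_edge_vpoint ab).
rewrite proj_vpoint subr0 ger0_norm//.
by case/andP: s01.
Qed.

Lemma proj_lipschitz x y : dist (fproj x) (fproj y) <= dist x y.
Proof.
have edge z : (exists v : X, z = vpoint v) \/ (exists a b s, on_edge z a b s).
  exact: graph_point_edge.
have vlip (v : X) z : dist (vpoint v.1) (fproj z) <= dist (vpoint v) z.
  have [[w ->]|[a [b [s zab]]]] := edge z.
    by rewrite proj_vpoint dist_proj_vertex.
  have h1 := proj_end zab; have h2 := proj_end (on_edge_flip zab).
  rewrite metric_sym in h1; rewrite metric_sym in h2.
  have t1 := metric_triangle (vpoint v.1) (vpoint a.1) (fproj z).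
  have t2 := metric_triangle (vpoint v.1) (vpoint b.1) (fproj z).
  have d1 := dist_proj_vertex v a; have d2 := dist_proj_vertex v b.
  by case: (dist_vpoint v zab) => ->; lra.
have [[w ->]|[a [b [s xab]]]] := edge x; first by rewrite proj_vpoint.
have h1 := proj_end xab; have h2 := proj_end (on_edge_flip xab).
have t1 := metric_triangle (fproj x) (vpoint a.1) (fproj y).
have t2 := metric_triangle (fproj x) (vpoint b.1) (fproj y).
have d1 := vlip a y; have d2 := vlip b y.
have [[t yab]|->|->] := dist_exit y xab; [|lra|lra].
by rewrite (on_edge_dist xab yab); exact: proj_same_edge xab yab.
Qed.

(** The distance can exceed its projection only if [c] lies in the fibre of an end of the edge of
    [y]; then the other end is adjacent to [c] and gives the route of length [1 + (1 - t)]. *)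
Lemma dist_vpoint_horizontal c y b e t : horizontal y b e t ->
  dist (vpoint c) y <= dist (vpoint c.1) (fproj y) \/
  (dist (vpoint c) y <= 2 - dist (vpoint c.1) (fproj y) /\
   dist (vpoint c.1) (fproj y) <= 1).
Proof.
move=> ybe.
wlog h : b e t ybe / dist (vpoint c.1) (fproj y) =
    t + dist (vpoint c.1) (vpoint b.1) => [hwlog|].
  have [h|h] := dist_vpoint c.1 (horizontal_proj ybe).
    exact: hwlog ybe h.
  exact: hwlog (horizontal_flip ybe) h.
have [yb ye] := on_edge_dist_ends (proj1 ybe); have [[_ t01 _] be] := ybe.
have [cb|cb] := pselect (c.1 = b.1).
  have := metric_triangle (vpoint c) (vpoint e) y.
  have -> : dist (vpoint (R := R) c) (vpoint e) = 1.
    by apply: dist_hadj; rewrite cb.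
  rewrite -cb mdistxx in h; rewrite metric_sym in ye.
  by rewrite ye => ?; right; lra.
have := metric_triangle (vpoint c) (vpoint b) y.
by rewrite metric_sym in yb; rewrite (dist_fibre_neq cb) yb => ?; left; lra.
Qed.

(** The two ways of orienting an edge, so that one statement covers all four choices of an end on
    each of two edges. *)
Variant edge_end a b s : X -> X -> R -> Prop :=
| edge_end_id : edge_end a b s a b s
| edge_end_flip : edge_end a b s b a (1 - s).

Lemma edge_end_horizontal x a b s a' b' s' : edge_end a b s a' b' s' ->
  horizontal x a b s -> horizontal x a' b' s'.
Proof. by case=> // /horizontal_flip. Qed.

(** As [b] is adjacent to [c] and [a] to [e], there are the routes [x b c y] and [x a e y]. *)
Lemma horizontal_fibre_dist x y a b s c e t : horizontal x a b s ->
  horizontal y c e t -> a.1 = c.1 ->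
  dist x y <= 2 - s + t /\ dist x y <= 2 + s - t.
Proof.
move=> [xab ab] [yce ce] ac.
have [xa xb] := on_edge_dist_ends xab; have [yc ye] := on_edge_dist_ends yce.
have t1 := metric_triangle x (vpoint b) y.
have t2 := metric_triangle (vpoint b) (vpoint c) y.
have t3 := metric_triangle x (vpoint a) y.
have t4 := metric_triangle (vpoint a) (vpoint e) y.
have bc : dist (vpoint (R := R) b) (vpoint c) = 1.
  by apply: dist_hadj; rewrite -ac; exact: adj_sym.
have ae : dist (vpoint (R := R) a) (vpoint e) = 1.
  by apply: dist_hadj; rewrite ac.
rewrite metric_sym in yc; rewrite metric_sym in ye.
by split; lra.
Qed.

(** A geodesic of [G1] between the projections lifts without loss unless the two edges have ends in
    one fibre. In that case the projections are joined either through the common vertex or along a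
    common edge. *)
Lemma horizontal_dist x y a b s c e t : horizontal x a b s ->
  horizontal y c e t ->
  dist x y <= dist (fproj x) (fproj y) \/
  exists a' b' s' c' e' t',
    [/\ edge_end a b s a' b' s', edge_end c e t c' e' t', a'.1 = c'.1 &
      dist (fproj x) (fproj y) = s' + t' \/
      (b'.1 = e'.1 /\ dist (fproj x) (fproj y) = `|s' - t'|)].
Proof.
move=> xab yce.
have px := horizontal_proj xab; have py := horizontal_proj yce.
have [[_ s01 _] _] := xab; have [[_ t01 _] ce] := yce.
have far a' b' s' c' e' t' : edge_end a b s a' b' s' ->
    edge_end c e t c' e' t' ->
    dist (fproj x) (fproj y) = s' + t' + dist (vpoint a'.1) (vpoint c'.1) ->
    dist x y <= dist (fproj x) (fproj y) \/
    (a'.1 = c'.1 /\ dist (fproj x) (fproj y) = s' + t').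
  move=> ea ec ->.
  have [xa' _] := on_edge_dist_ends (edge_end_horizontal ea xab).1.
  have [yc' _] := on_edge_dist_ends (edge_end_horizontal ec yce).1.
  have [ac|ac] := pselect (a'.1 = c'.1).
    by right; rewrite ac mdistxx addr0.
  left; rewrite -dist_fibre_neq//.
  have := metric_triangle x (vpoint a') y.
  have := metric_triangle (vpoint a') (vpoint c') y.
  by rewrite metric_sym in yc'; lra.
have near a' b' s' c' e' t' : edge_end a b s a' b' s' ->
    edge_end c e t c' e' t' ->
    dist x y <= dist (fproj x) (fproj y) \/
    (a'.1 = c'.1 /\ dist (fproj x) (fproj y) = s' + t') ->
    dist x y <= dist (fproj x) (fproj y) \/
    exists a' b' s' c' e' t',
    [/\ edge_end a b s a' b' s', edge_end c e t c' e' t', a'.1 = c'.1 &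
      dist (fproj x) (fproj y) = s' + t' \/
      (b'.1 = e'.1 /\ dist (fproj x) (fproj y) = `|s' - t'|)].
  move=> ea ec [?|[ac dxy]]; [by left|right].
  by exists a', b', s', c', e', t'; split=> //; left.
have [i f] := (edge_end_id, edge_end_flip).
have [[t0 pyab]|dx|dx] := dist_exit (fproj y) px.
- have dxy := on_edge_dist px pyab; have [ab1 t001 pyE] := pyab.
  have [_ _ pyE'] := py; rewrite pyE' in pyE.
  have [[ca eb tt]|[cb ea tt]|[w [_ h1 h2]]] := edge_edge_eq ce ab1 pyE.
  + right; exists a, b, s, c, e, t; split=> //; right; split=> //.
    by rewrite dxy tt.
  + right; exists a, b, s, e, c, (1 - t); split=> //; right; split=> //.
    by rewrite dxy tt subKr.
  (* The projection of [y] is an end of both projected edges; oriented from it, [y] has parameter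
     0. *)
  + case: h1 => -[e1 t1]; case: h2 => -[e2 t2].
    * apply: (near a b s c e t) => //; right.
      rewrite -e1 -e2 dxy; split=> //.
      by rewrite ger0_norm; lra.
    * apply: (near b a (1 - s) c e t) => //; right.
      rewrite -e1 -e2 dxy; split=> //.
      by rewrite ler0_norm; lra.
    * apply: (near a b s e c (1 - t)) => //; right.
      rewrite -e1 -e2 dxy; split=> //.
      by rewrite ger0_norm; lra.
    * apply: (near b a (1 - s) e c (1 - t)) => //; right.
      rewrite -e1 -e2 dxy; split=> //.
      by rewrite ler0_norm; lra.
- have [dy|dy] := dist_vpoint a.1 py.
  + by apply: (near a b s c e t) => //; apply: (far a b s c e t) => //; lra.
  + by apply: (near a b s e c (1 - t)) => //;
      apply: (far a b s e c (1 - t)) => //; lra.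
- have [dy|dy] := dist_vpoint b.1 py.
  + by apply: (near b a (1 - s) c e t) => //;
      apply: (far b a (1 - s) c e t) => //; lra.
  + by apply: (near b a (1 - s) e c (1 - t)) => //;
      apply: (far b a (1 - s) e c (1 - t)) => //; lra.
Qed.

(* The distance from [x] to the union of the horizontal edges, which contains
   all the vertices. *)
Definition height x (v : R) : Prop :=
  ((exists a b s, horizontal x a b s) /\ v = 0) \/
  (exists a b, [/\ on_edge x a b v, a.1 = b.1 & v <= 1 / 2]).

Lemma height_exists x : exists v, height x v.
Proof.
have hor a b s : horizontal x a b s -> exists v, height x v.
  by move=> xab; exists 0; left; split=> //; exists a, b, s.
have [[w xw]|[a [b [s xab]]]] := graph_point_edge x.
  by have [b] := vpoint_horizontal w; rewrite -xw; exact: hor.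
have [[ab|[ab _]] s01 _] := xab; first exact: (hor a b s).
case: (leP s (1 / 2)) => s2; first by exists s; right; exists a, b.
by exists (1 - s); right; exists b, a; split; [exact: on_edge_flip|by []|lra].
Qed.

Lemma height_bound x v : height x v -> 0 <= v <= 1 / 2.
Proof.
case=> [[_ ->]|[a [b [[_ h _] _ h2]]]]; last by lra.
by rewrite lexx divr_ge0.
Qed.

Lemma height0_horizontal x : height x 0 -> exists a b s, horizontal x a b s.
Proof.
case=> [[]//|[a [b [/on_edge0 -> _ _]]]].
by have [c ?] := vpoint_horizontal a; exists a, c, 0.
Qed.

(** From a point of height [v] on a vertical edge, both ends are at distance at least [v], so a ball
    of that radius projects to one vertex. *)
Lemma height_proj x v y : height x v -> dist x y <= v -> fproj y = fproj x.
Proof.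
case=> [[_ ->] /dist_eq0 ->//|[a [b [xab ab v2]]] xy].
rewrite (vertical_proj xab ab).
have [[t yab]|h|h] := dist_exit y xab.
- exact: vertical_proj yab ab.
- suff <- : vpoint a = y by rewrite proj_vpoint.
  by apply: dist_eq0; lra.
- suff <- : vpoint b = y by rewrite proj_vpoint ab.
  by apply: dist_eq0; lra.
Qed.

Lemma height_exit x v y : height x v -> fproj x <> fproj y ->
  exists2 x', fproj x' = fproj x & v + dist x' y <= dist x y.
Proof.
case=> [[_ ->] _|[a [b [xab ab v2]]] nxy]; first by exists x => //; rewrite add0r.
have px := vertical_proj xab ab.
have [[t yab]|h|h] := dist_exit y xab.
- by case: nxy; rewrite px (vertical_proj yab ab).
- by exists (vpoint a); [rewrite proj_vpoint px|lra].
- by exists (vpoint b); [rewrite proj_vpoint px ab|lra].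
Qed.

(** A path between different fibres must first descend from the vertical edges at its two ends,
    which the projection does not see. *)
Lemma dist_lower x y vx vy : height x vx -> height y vy -> fproj x <> fproj y ->
  dist (fproj x) (fproj y) + vx + vy <= dist x y.
Proof.
move=> hx hy nxy; have [x' ex h1] := height_exit hx nxy.
have nyx : fproj y <> fproj x' by rewrite ex; exact: nesym.
have [y' ey h2] := height_exit hy nyx.
have := proj_lipschitz y' x'; rewrite ex ey metric_sym => h3.
by rewrite [dist y x']metric_sym in h2; lra.
Qed.

(** The counterpart of [dist_lower], with its exceptions. The second is ruled out later by lengths;
    the third is the case in which a side need not project to a geodesic. *)
Lemma dist_upper x y vx vy : height x vx -> height y vy ->
  [\/ dist x y <= dist (fproj x) (fproj y) + vx + vy,
      dist (fproj x) (fproj y) <= 1 /\ dist x y <= 3 |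
      [/\ vx = 0, vy = 0, dist x y <= 2 &
        exists a b s c e t, [/\ horizontal x a b s, horizontal y c e t,
          a.1 = c.1 & dist (fproj x) (fproj y) = s + t]]].
Proof.
move=> hx hy; have vx2 := height_bound hx; have vy2 := height_bound hy.
have vh z a b v y' c e t : on_edge z a b v -> a.1 = b.1 -> v <= 1 / 2 ->
    horizontal y' c e t -> dist z y' <= dist (fproj z) (fproj y') + v \/
    (dist (fproj z) (fproj y') <= 1 /\ dist z y' <= 3).
  move=> zab ab v2 y'ce; have [za _] := on_edge_dist_ends zab.
  have := metric_triangle z (vpoint a) y'; rewrite (vertical_proj zab ab) za.
  have d0 := mdist_ge0 (vpoint a.1) (fproj y').
  by have [h|[h h']] := dist_vpoint_horizontal a y'ce; [left|right]; lra.
case: hx hy => [[[a [b [s xab]]] ex]|[a [b [xab ab v2]]]]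
  [[[c [e [t yce]]] ey]|[c [e [yce ce w2]]]].
- have [h|[a' [b' [s' [c' [e' [t' [ea ec ac h]]]]]]]] := horizontal_dist xab yce.
    by constructor 1; lra.
  have xab' := edge_end_horizontal ea xab; have yce' := edge_end_horizontal ec yce.
  have [h1 h2] := horizontal_fibre_dist xab' yce' ac.
  have [[_ s01 _] _] := xab'; have [[_ t01 _] _] := yce'.
  (* The two routes in [h1] and [h2] have average length 2, so the shorter is at most 2. *)
  case: h => [h|[_ h]].
    constructor 3; split=> //; first lra.
    by exists a', b', s', c', e', t'.
  constructor 2; split; last lra.
  by rewrite h; case: (norm_cases (s' - t')) => -[-> ?]; lra.
- have [h|[h h']] := vh y c e vy x a b s yce ce w2 xab.
    by constructor 1; rewrite metric_sym [dist (fproj x) _]metric_sym; lra.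
  by constructor 2; rewrite metric_sym [dist x _]metric_sym.
- have [h|h] := vh x a b vx y c e t xab ab v2 yce; last by constructor 2.
  by constructor 1; lra.
have [xa _] := on_edge_dist_ends xab; have [yc _] := on_edge_dist_ends yce.
have := metric_triangle x (vpoint a) y.
have := metric_triangle (vpoint a) (vpoint c) y.
rewrite metric_sym in yc; rewrite xa yc.
rewrite (vertical_proj xab ab) (vertical_proj yce ce) => t1 t2.
have [ac|ac] := pselect (a.1 = c.1).
  have := dist_fibre_eq ac => h; constructor 2.
  by rewrite ac mdistxx ler01; split=> //; lra.
by rewrite (dist_fibre_neq ac) in t1; constructor 1; lra.
Qed.

End Projection.

(** * Comparing the sides of a triangle with their projections *)

Section SideComparison.
Context {R : realType} {G1 G2 : graph}.
Local Notation X := (lexicographic_product G1 G2).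
Hypothesis nt : nontrivial_graph G1.
Implicit Types (a b c e : X) (r s t : R) (x z p q : graph_point R X).

(** The pieces of length [vx] and [vz] at the ends project to points by [height_proj]; in between no
    distance can shrink. A point of positive height there would, by [dist_lower], be too far from
    [x] or [z]. *)
Lemma straight_geodesic x z vx vz (g : R -> graph_point R X) :
  height x vx -> height z vz -> g 0 = x -> g (dist x z) = z ->
  isometric_on g 0 (dist x z) -> 0 < dist (fproj x) (fproj z) ->
  dist x z <= dist (fproj x) (fproj z) + vx + vz ->
  [/\ dist x z = dist (fproj x) (fproj z) + vx + vz,
    fproj (g vx) = fproj x, fproj (g (dist x z - vz)) = fproj z,
    isometric_on (fproj \o g) vx (dist x z - vz) &
    forall r, vx <= r <= dist x z - vz -> exists a b s, horizontal (g r) a b s].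
Proof.
move=> hx hz g0 gL giso m0 Lle.
have vx2 := height_bound hx; have vz2 := height_bound hz.
have nxz := dist_gt0_neq m0.
have L : dist x z = dist (fproj x) (fproj z) + vx + vz.
  by have := dist_lower nt hx hz nxz; lra.
have dxg r : 0 <= r <= dist x z -> dist x (g r) = r.
  move=> hr; have := giso 0 r; rewrite g0 => ->; [|lra|lra].
  by rewrite ler0_norm; lra.
have dgz r : 0 <= r <= dist x z -> dist (g r) z = dist x z - r.
  move=> hr; have := giso r (dist x z); rewrite gL => ->; [|lra|lra].
  by rewrite ler0_norm; lra.
have px : fproj (g vx) = fproj x by apply: (height_proj nt hx); rewrite dxg; lra.
have pz : fproj (g (dist x z - vz)) = fproj z.
  by apply: (height_proj nt hz); rewrite metric_sym dgz; lra.
have piso : isometric_on (fproj \o g) vx (dist x z - vz).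
  apply: lipschitz_isometric; [exact: proj_lipschitz|lra| |].
    by move=> s t hs ht; apply: giso; lra.
  by rewrite px pz; lra.
split=> // r hr; have [v hv] := height_exists nt (g r).
have v2 := height_bound hv.
suff v0 : v = 0 by apply: (height0_horizontal nt); rewrite -v0.
(* Since [dist_lower] asks for distinct projections, the comparison is with [z] when [r = vx] and
   with [x] afterwards. *)
case: (leP r vx) => rx.
  have dz : dist (fproj (g r)) (fproj z) = dist x z - vz - r.
    by rewrite -pz; have := piso r (dist x z - vz); rewrite /= => ->; [|lra|lra];
      rewrite ler0_norm; lra.
  have ne : fproj (g r) <> fproj z by apply: dist_gt0_neq; rewrite dz; lra.
  by have := dist_lower nt hv hz ne; rewrite dz dgz; lra.
have dx : dist (fproj x) (fproj (g r)) = r - vx.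
  by rewrite -px; have := piso vx r; rewrite /= => ->; [|lra|lra];
    rewrite ler0_norm; lra.
have ne : fproj x <> fproj (g r) by apply: dist_gt0_neq; rewrite dx; lra.
by have := dist_lower nt hx hv ne; rewrite dx dxg; lra.
Qed.

(** The trouble is a fibre shared by the edges of [p] and [g r]. Moving back along [g] leaves it,
    and [3 / 2 < r] with [vx <= 1 / 2] leaves room for a full edge. *)
Lemma straight_close x vx (g : R -> graph_point R X) (J r : R) p a b s :
  height x vx -> fproj (g vx) = fproj x -> isometric_on (fproj \o g) vx J ->
  (forall r, vx <= r <= J -> exists a b s, horizontal (g r) a b s) ->
  horizontal p a b s -> 3 / 2 < r <= J ->
  exists2 r', vx <= r' <= J & dist p (g r') <= dist (fproj p) (fproj (g r)) + 3 / 2.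
Proof.
move=> hx px piso ghor pab rJ; have vx2 := height_bound hx.
have pisoE t u : vx <= t <= u -> u <= J ->
    dist (fproj (g u)) (fproj (g t)) = u - t.
  move=> tu uJ; have := piso u t; rewrite /= => ->; [|lra|lra].
  by rewrite ger0_norm; lra.
(* Here both edges project to the same edge, and going back from [r] the curve leaves it through
   [d]. *)
have main c c' u d d' v : horizontal p c c' u -> horizontal (g r) d d' v ->
    c.1 = d.1 -> c'.1 = d'.1 -> fproj (g (r - v)) = vpoint d.1 ->
    exists2 r', vx <= r' <= J & dist p (g r') <= `|u - v| + 3 / 2.
  move=> pcc qdd cd cd' gv.
  have [[_ v01 _] _] := qdd; have [[_ u01 _] cc] := pcc.
  have [pc pc'] := on_edge_dist_ends (proj1 pcc).
  have n1 := ler_norm (u - v).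
  have n2 := ler_norm (- (u - v)); rewrite normrN in n2.
  (* If [p] is within 1/2 of [c'], then [g (r - v)] lies over [d], one edge away from [c']. *)
  case: (leP (1 / 2) u) => u2.
    exists (r - v); first lra.
    have [a1 [b1 [s1 q1]]] : exists a b s, horizontal (g (r - v)) a b s.
      by apply: ghor; lra.
    have t1 := metric_triangle p (vpoint c') (g (r - v)).
    have := dist_vpoint_horizontal c' q1.
    rewrite gv -cd (dist_adj (adj_sym cc)).
    by case=> [?|[? _]]; lra.
  (* Otherwise the route goes through [c] to the point 3/2 before [r], which projects to distance
     [3 / 2 - v] from [d], or to [g vx] if that comes first. *)
  case: (leP vx (r - 3 / 2)) => rx.
    exists (r - 3 / 2); first lra.
    have [a1 [b1 [s1 q1]]] : exists a b s, horizontal (g (r - 3 / 2)) a b s.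
      by apply: ghor; lra.
    have t1 := metric_triangle p (vpoint c) (g (r - 3 / 2)).
    have := dist_vpoint_horizontal c q1.
    rewrite cd -gv pisoE; [|lra|lra].
    by case=> [?|[? _]]; lra.
  exists vx; first lra.
  have [a1 [b1 [s1 q1]]] : exists a b s, horizontal (g vx) a b s.
    by apply: ghor; lra.
  have t1 := metric_triangle p (vpoint c) (g vx).
  have dv : dist (vpoint d.1) (fproj (g vx)) = r - v - vx.
    by rewrite -gv pisoE; lra.
  (* Now [vx] is positive, so [x] projects to a vertex, and its distance to the vertex [d.1] is a
     positive integer. *)
  have ge1 : 1 <= r - v - vx.
    case: hx => [[_ v0]|[e [f [xef ef _]]]]; first by lra.
    move: dv; rewrite px (vertical_proj xef ef) => dv.
    by rewrite -dv; apply: dist_vertex_ge1; rewrite dv; lra.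
  have := dist_vpoint_horizontal c q1; rewrite cd dv.
  by case=> [?|[? _]]; lra.
have [e [f [w qef]]] : exists a b s, horizontal (g r) a b s by apply: ghor; lra.
have [h|[c [c' [u [d [d' [v [ea ed cd h]]]]]]]] := horizontal_dist pab qef.
  by exists r; lra.
move/(edge_end_horizontal ea): pab => {ea a b s} pcc.
move/(edge_end_horizontal ed): qef => {ed e f w} qdd.
have qd := horizontal_proj qdd; have [[_ v01 _] _] := qdd.
have [[_ u01 _] _] := pcc.
(* If the projections are joined through the common vertex, one step back suffices: [g (r - 1)]
   projects to distance between [1 - v] and [1 + v] from it, so [p] is within [u + v + 1]. *)
case: h => [->|[cd' ->]].
  exists (r - 1); first lra.
  have [a [b [s q1]]] : exists a b s, horizontal (g (r - 1)) a b s.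
    by apply: ghor; lra.
  have [pc _] := on_edge_dist_ends (proj1 pcc).
  have [qdE _] := on_edge_dist_ends qd.
  have q1E : dist (fproj (g r)) (fproj (g (r - 1))) = 1 by rewrite pisoE; lra.
  have t1 := metric_triangle p (vpoint c) (g (r - 1)).
  have t2 := metric_triangle (vpoint c.1) (fproj (g r)) (fproj (g (r - 1))).
  have t3 := metric_triangle (fproj (g r)) (vpoint c.1) (fproj (g (r - 1))).
  rewrite -cd in qdE; rewrite metric_sym in t2.
  rewrite [dist (vpoint _) (fproj (g r))]metric_sym in t2.
  have [h|[h _]] := dist_vpoint_horizontal c q1;
    rewrite [dist (fproj (g (r - 1))) _]metric_sym in t2; lra.
have fiso : isometric_on (fun t => fproj (g (r - t))) 0 1.
  move=> t t' ht ht'; have := piso (r - t) (r - t'); rewrite /= => ->; [|lra|lra].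
  rewrite distrC; congr `|_|; lra.
have f0 : (fun t => fproj (g (r - t))) 0 = fproj (g r) by rewrite subr0.
have [h|h] := geodesic_exit qd f0 fiso; first exact: main pcc qdd cd cd' h.
have -> : `|u - v| = `|(1 - u) - (1 - v)| by rewrite distrC; congr `|_|; lra.
exact: main (horizontal_flip pcc) (horizontal_flip qdd) cd' cd h.
Qed.

(* Here [A] is longer than its ends' projections are apart, so it does not project
   to a geodesic; it passes, however, through two horizontally adjacent vertices,
   one of them in the fibre of [a]. *)
Lemma bent_close x z a a' s e e' t (A : set (graph_point R X)) p c c' u
    (q' : graph_point R G1) :
  is_geodesic x z A -> horizontal x a a' s -> horizontal z e e' t ->
  a.1 = e.1 -> dist (fproj x) (fproj z) = s + t ->
  3 / 2 < s + t < dist x z -> dist x z <= 2 ->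
  horizontal p c c' u -> 3 / 2 < dist (fproj x) q' ->
  dist (fproj x) q' + dist q' (fproj z) = s + t ->
  exists2 q, A q & dist p q <= dist (fproj p) q' + 3 / 2.
Proof.
move=> gA xaa zee ae m mL L2 pcc q'x q'z.
have [Ax Az] := geodesic_ends gA.
have [g [g0 gL giso AE]] := is_geodesicP gA.
have Ag r : 0 <= r <= dist x z -> A (g r) by move=> hr; apply/AE; exists r.
have [xa xa'] := on_edge_dist_ends (proj1 xaa).
have [ze ze'] := on_edge_dist_ends (proj1 zee).
have [[_ s01 _] aa] := xaa; have [[_ t01 _] ee] := zee.
have [k1 k2] := horizontal_fibre_dist xaa zee ae.
have [f [fa Af [f' ff' Af']]] : exists f : X, [/\ f.1 = a.1, A (vpoint f) &
    exists2 f' : X, adj f.1 f'.1 & A (vpoint f')].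
  have giso1 : isometric_on g 0 1 by move=> i j hi hj; apply: giso; lra.
  have gisor : isometric_on (fun r => g (dist x z - r)) 0 1.
    have := isometric_rev giso => h i j hi hj; apply: h; lra.
  have gr0 : (fun r => g (dist x z - r)) 0 = z by rewrite subr0.
  have [ga|ga] := geodesic_exit (proj1 xaa) g0 giso1;
    have [ge|ge] := geodesic_exit (proj1 zee) gr0 gisor.
  (* Passing through both [a] and [e] is impossible: they would be at a positive distance of less
     than 1. *)
  - have dae : dist (vpoint a) (vpoint e) = dist x z - t - s.
      by rewrite -ga -ge giso ?ler0_norm; lra.
    have : 1 <= dist x z - t - s.
      by rewrite -dae; apply: dist_vertex_ge1; rewrite dae; lra.
    by lra.
  - exists a; split=> //; first by rewrite -ga; apply: Ag; lra.
    by exists e'; [rewrite ae|rewrite -ge; apply: Ag; lra].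
  - exists e; split=> //; first by rewrite -ge; apply: Ag; lra.
    by exists a'; [rewrite -ae|rewrite -ga; apply: Ag; lra].
  (* Nor can it pass through [a'] and [e']: their projections are more than 1, hence at least 2
     apart, but [dist x z - 2 + s + t < 2]. *)
  have far : 1 < dist (vpoint (R := R) a'.1) (vpoint e'.1).
    have t1 := metric_triangle (fproj x) (vpoint a'.1) (fproj z).
    have t2 := metric_triangle (vpoint a'.1) (vpoint e'.1) (fproj z).
    have [_ pa'] := on_edge_dist_ends (horizontal_proj xaa).
    have [_ pe'] := on_edge_dist_ends (horizontal_proj zee).
    by rewrite metric_sym in pe'; lra.
  have := dist_vertex_ge2 far; have := dist_proj_vertex (R := R) a' e'.
  have -> : dist (vpoint a') (vpoint e') = dist x z - 2 + s + t.
    by rewrite -ga -ge giso ?ler0_norm; lra.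
  by lra.
(* As [s + t < 2], the point [q'] is within 1/2 of the projection of [z], so [p] is compared with
   [z] instead. *)
have t0 := metric_triangle (fproj p) q' (fproj z).
have [h|[d [d' [v [k [k' [w [ed ek dk h]]]]]]]] := horizontal_dist pcc zee.
  by exists z => //; lra.
move/(edge_end_horizontal ed): pcc => {ed c c' u} pdd.
have [[_ v01 _] dd] := pdd.
have [pd pd'] := on_edge_dist_ends (proj1 pdd).
have tdf := metric_triangle p (vpoint d) (vpoint f).
have tdf' := metric_triangle p (vpoint d) (vpoint f').
have td'f := metric_triangle p (vpoint d') (vpoint f).
have td'f' := metric_triangle p (vpoint d') (vpoint f').
case: ek dk h => dk h.
  have h1 : dist (vpoint (R := R) d) (vpoint f') = 1.
    by apply: dist_hadj; rewrite dk -ae -fa.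
  case: h => [h|[d'e' _]].
    exists x => //.
    have [_ k3] := horizontal_fibre_dist pdd xaa (etrans dk (esym ae)).
    by lra.
  have h2 : dist (vpoint (R := R) d') (vpoint f) = 1.
    by apply: dist_hadj; rewrite d'e' fa ae; exact: adj_sym.
  have d0 := mdist_ge0 (fproj p) q'.
  (* One end of the edge of [p] is within 1/2, and each of them is adjacent to [f] or [f']. *)
  case: (leP v (1 / 2)) => v2; first by exists (vpoint f') => //; lra.
  by exists (vpoint f) => //; lra.
have h1 : dist (vpoint (R := R) d) (vpoint f) = 1.
  by apply: dist_hadj; rewrite dk fa ae; exact: adj_sym.
case: h => [h|[d'e _]]; first by exists (vpoint f) => //; lra.
have h2 : dist (vpoint (R := R) d') (vpoint f') = 1.
  by apply: dist_hadj; rewrite d'e -ae -fa.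
have d0 := mdist_ge0 (fproj p) q'.
case: (leP v (1 / 2)) => v2; first by exists (vpoint f) => //; lra.
by exists (vpoint f') => //; lra.
Qed.

Lemma straight_geodesic_proj x z vx vz (A : set (graph_point R X)) :
  is_geodesic x z A -> height x vx -> height z vz ->
  0 < dist (fproj x) (fproj z) ->
  dist x z <= dist (fproj x) (fproj z) + vx + vz ->
  exists2 g : R -> graph_point R X, [/\ fproj (g vx) = fproj x,
    isometric_on (fproj \o g) vx (dist x z - vz),
    (forall r, vx <= r <= dist x z - vz -> exists a b s, horizontal (g r) a b s),
    (forall r, 0 <= r <= dist x z -> A (g r)) &
    (forall q, A q -> q = g (dist x q))] &
    exists2 A', is_geodesic (fproj x) (fproj z) A' &
      forall y, A' y <-> exists2 r, vx <= r <= dist x z - vz & y = fproj (g r).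
Proof.
move=> gA hx hz m0 Lle.
have vx2 := height_bound hx; have vz2 := height_bound hz.
have [g [g0 gL giso AE]] := is_geodesicP gA.
have [L px pz piso ghor] := straight_geodesic hx hz g0 gL giso m0 Lle.
have dxg r : 0 <= r <= dist x z -> dist x (g r) = r.
  move=> hr; have := giso 0 r; rewrite g0 => ->; [|lra|lra].
  by rewrite ler0_norm; lra.
exists g; [split=> //|].
- by move=> r hr; apply/AE; exists r.
- by move=> q /AE[r hr ->]; rewrite dxg.
exists ((fun r => fproj (g (vx + r))) @` `[0, dist (fproj x) (fproj z)]).
  apply: isometric_geodesic; first by rewrite addr0.
    by rewrite -[RHS]pz; congr (fproj (g _)); lra.
  move=> i j hi hj; have := piso (vx + i) (vx + j); rewrite /= => ->; [|lra|lra].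
  by congr `|_|; lra.
move=> y; split=> [[r /=]|[r hr ->]].
  by rewrite in_itv /= => hr <-; exists (vx + r) => //; lra.
exists (r - vx); first by rewrite /= in_itv /=; lra.
by congr (fproj (g _)); lra.
Qed.

(** The side [A'] is chosen before [p] and [q'], since the comparison triangle must be complete
    before thinness yields [q']. It is the projection of [A] when that is geodesic, and arbitrary
    otherwise; if the ends project close together, no [q'] qualifies. *)
Lemma side_close x z vx (A : set (graph_point R X)) :
  is_geodesic x z A -> height x vx ->
  exists2 A', is_geodesic (fproj x) (fproj z) A' &
    forall p a b s (q' : graph_point R G1), horizontal p a b s -> A' q' ->
      3 / 2 - vx < dist (fproj x) q' ->
      exists2 q, A q & dist p q <= dist (fproj p) q' + 3 / 2.
Proof.
move=> gA hx; have vx2 := height_bound hx.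
have [vz hz] := height_exists nt z; have vz2 := height_bound hz.
have [A' gA'] := geodesic_exists (fproj x) (fproj z).
case: (leP (dist (fproj x) (fproj z)) (3 / 2 - vx)) => m.
  exists A' => // p a b s q' _ A'q' h.
  have := geodesic_between gA' A'q'; have := mdist_ge0 q' (fproj z) => h1 h2.
  suff : 3 / 2 - vx < 3 / 2 - vx by rewrite ltxx.
  by lra.
case: (leP (dist x z) (dist (fproj x) (fproj z) + vx + vz)) => Lle.
  have m0 : 0 < dist (fproj x) (fproj z) by lra.
  have [g [px piso ghor Ag _] [B' gB' B'E]] :=
    straight_geodesic_proj gA hx hz m0 Lle.
  exists B' => // p a b s q' pab /B'E[r hr ->] h.
  have r32 : 3 / 2 < r <= dist x z - vz.
    move: h; rewrite -px; have := piso vx r; rewrite /= => ->; [|lra|lra].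
    by rewrite ler0_norm; lra.
  have [r' hr' le] := straight_close hx px piso ghor pab r32.
  by exists (g r') => //; apply: Ag; lra.
exists A' => // p c c' u q' pcc A'q' h.
have [?|[? _]|[vx0 vz0 L2 [a [a' [s [e [e' [t [xaa zee ae mE]]]]]]]]] :=
  dist_upper nt hx hz; [lra|lra|].
have between := geodesic_between gA' A'q'.
by apply: (bent_close gA xaa zee ae mE _ L2 pcc); lra.
Qed.

(* Projecting may bring [p] closer to [x] by [vx]; this is why [side_close] asks
   for [3 / 2 - vx] only. *)
Lemma triangle_side_close (D : R) : 0 < D ->
  (forall (x y z p : graph_point R G1) A B C, is_geodesic x y A ->
    is_geodesic y z B -> is_geodesic z x C -> A p ->
    exists2 q : graph_point R G1, B q \/ C q & dist p q < D) ->
  forall (x y z : graph_point R X) A B C p, is_geodesic x y A ->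
    is_geodesic y z B -> is_geodesic z x C -> A p ->
    exists2 q, B q \/ C q & dist p q <= D + 3 / 2.
Proof.
move=> D0 hyp x y z A B C p gA gB gC Ap.
have [_ Cx] := geodesic_ends gC; have [By _] := geodesic_ends gB.
have xpy := geodesic_between gA Ap.
case: (leP (dist x p) (D + 3 / 2)) => px.
  by exists x; [right|rewrite metric_sym].
case: (leP (dist p y) (D + 3 / 2)) => py; first by exists y; [left|].
have [vx hx] := height_exists nt x; have vx2 := height_bound hx.
have [vy hy] := height_exists nt y; have vy2 := height_bound hy.
(* The side is longer than 3, which excludes the exceptional cases. *)
have [Lle|[_ ?]|[_ _ ? _]] := dist_upper nt hx hy; [|lra|lra].
have m0 : 0 < dist (fproj x) (fproj y) by lra.
have [g [gvx piso ghor _ gE] [A' gA' A'E]] :=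
  straight_geodesic_proj gA hx hy m0 Lle.
have pE := gE p Ap.
have [B' gB' closeB] := side_close gB hy.
have [C' gC' closeC] := side_close (is_geodesic_sym gC) hx.
have rJ : vx <= dist x p <= dist x y - vy by lra.
have A'p : A' (fproj p) by apply/A'E; exists (dist x p) => //; rewrite -pE.
have [a [b [s pab]]] : exists a b s, horizontal p a b s.
  by rewrite pE; exact: ghor.
have dxp : dist (fproj x) (fproj p) = dist x p - vx.
  rewrite -gvx [in LHS]pE; have := piso vx (dist x p).
  by rewrite /= => ->; [rewrite ler0_norm|..]; lra.
have := geodesic_between gA' A'p; rewrite dxp => dpy.
have [q' BC' pq'] := hyp _ _ _ _ _ _ _ gA' gB' (is_geodesic_sym gC') A'p.
case: BC' => [B'q'|C'q'].
  have t1 := metric_triangle (fproj p) q' (fproj y).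
  have h : 3 / 2 - vy < dist (fproj y) q' by rewrite [ltRHS]metric_sym; lra.
  have [q Bq le] := closeB _ _ _ _ _ pab B'q' h.
  by exists q; [left|lra].
have t1 := metric_triangle (fproj x) q' (fproj p).
have h : 3 / 2 - vx < dist (fproj x) q'.
  by rewrite [dist q' _]metric_sym in t1; lra.
have [q Cq le] := closeC _ _ _ _ _ pab C'q' h.
by exists q; [right|lra].
Qed.

End SideComparison.

(** * Thin triangles and the hyperbolicity constant *)

Section ThinTriangles.
Context {R : realType} (X : metricType R).

Lemma triangle_delta_ge0 (T : geodesic_triangle X) : (0 <= triangle_delta T)%E.
Proof. by apply: le_ereal_inf_tmp => _ [t [t0 _] <-]; rewrite lee_fin. Qed.

(** Both the thinness constant and the distance to a set are infima that need not be attained; the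
    slack [e] yields an actual point [q]. *)
Lemma hyperbolicity_close (h e : R) : (hyperbolicity X <= h%:E)%E -> 0 < e ->
  forall (x y z p : X) A B C, is_geodesic x y A -> is_geodesic y z B ->
    is_geodesic z x C -> A p -> exists2 q, B q \/ C q & dist p q < h + e.
Proof.
move=> hX e0 x y z p A B C gA gB gC Ap.
have : (triangle_delta (GeodesicTriangle gA gB gC) < (h + e)%:E)%E.
  apply: le_lt_trans (_ : _ <= h%:E)%E _; last by rewrite lte_fin ltrDl.
  by apply: le_trans hX; apply: ereal_sup_ubound; eexists.
move=> /ereal_inf_lt[_ [t [_ [thin _ _]] <-]]; rewrite lte_fin => th.
have [By _] := geodesic_ends gB.
have ne : [set dist p q | q in B `|` C] !=set0.
  by exists (dist p y), y => //; left.
by have [_ [q BCq <-] pq] := inf_lt ne (le_lt_trans (thin p Ap) th); exists q.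
Qed.

Lemma hyperbolicity_le (D : R) : 0 <= D ->
  (forall (x y z p : X) A B C, is_geodesic x y A -> is_geodesic y z B ->
    is_geodesic z x C -> A p -> exists2 q, B q \/ C q & dist p q <= D) ->
  (hyperbolicity X <= D%:E)%E.
Proof.
move=> D0 close; apply: ge_ereal_sup => _ [T _ <-].
apply: ereal_inf_lbound; exists D => //; split=> //.
have point p (S : set X) : (exists2 q, S q & dist p q <= D) ->
    point_set_dist p S <= D.
  move=> [q Sq pq]; apply: le_trans pq; apply: ge_inf; last by exists q.
  by exists 0 => _ [q' _ <-]; exact: mdist_ge0.
case: T => x y z A B C gA gB gC.
split=> p /= hp; apply: point.
- by have [q hq pq] := close _ _ _ _ _ _ _ gA gB gC hp; exists q.
- by have [q hq pq] := close _ _ _ _ _ _ _ gB gC gA hp; exists q.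
- by have [q hq pq] := close _ _ _ _ _ _ _ gC gA gB hp; exists q.
Qed.

End ThinTriangles.

Theorem theorem3p14 (R : realType) (G1 G2 : graph) :
  nontrivial_graph G1 ->
  (graph_delta R (lexicographic_product G1 G2)
     <= graph_delta R G1 + (3 / 2 : R)%:E)%E.
Proof.
move=> nt; rewrite /graph_delta.
(* A degenerate triangle at a vertex rules out the value minus infinity. *)
have ge0 : (0 <= hyperbolicity (metric_graph R G1))%E.
  have [u] := graph_inhabited G1.
  have [A gA] := geodesic_exists (vpoint (R := R) u) (vpoint u).
  apply: le_trans (triangle_delta_ge0 (GeodesicTriangle gA gA gA)) _.
  by apply: ereal_sup_ubound; eexists.
case hE: (hyperbolicity (metric_graph R G1)) ge0 => [h| |] //; last first.
  by rewrite addye ?leey.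
rewrite lee_fin => h0.
(* The bound is proved up to every [e], which also makes [h + e] positive when [h = 0]. *)
apply/lee_addgt0Pr => e e0; rewrite -!EFinD.
have D0 : 0 < h + e by lra.
have -> : h + 3 / 2 + e = (h + e) + 3 / 2 by lra.
apply: hyperbolicity_le; first by lra.
move=> x y z p A B C gA gB gC Ap.
have hle : (hyperbolicity (metric_graph R G1) <= h%:E)%E by rewrite hE.
exact: (triangle_side_close nt D0 (hyperbolicity_close hle e0) gA gB gC Ap).
Qed.
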